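(* Let $\Theta,\mathcal A,h,p,q$ satisfy the standing assumptions in the context, and suppose that $h(\boldsymbol\theta,\boldsymbol\alpha)$ is $\sigma$-strongly concave in $\boldsymbol\alpha$ for any given $\boldsymbol\theta$. Then, to find an $\epsilon$-first-order Nash equilibrium of the game $\min_{\boldsymbol\theta\in\Theta}\max_{\boldsymbol\alpha\in\mathcal A}h(\boldsymbol\theta,\boldsymbol\alpha)-p(\boldsymbol\alpha)+q(\boldsymbol\theta)$, the Multi-step Accelerated Proximal Gradient Descent-Ascent algorithm (see context), run with $\eta_1=\frac1{L_{22}}$, $\eta_2=\big(L_{11}+\frac{L_{12}^2}{\sigma}\big)^{-1}$, $N=\sqrt{8L_{22}/\sigma}-1$ and suitable $T=\mathcal O(\epsilon^{-2})$, $K=\mathcal O(\log(\epsilon^{-1}))$, requires $\mathcal O(\epsilon^{-2}\log(\epsilon^{-1}))$ gradient evaluations of the objective function.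
   Context: Norms are Euclidean. Standing assumptions: $\Theta\subseteq\mathbb R^{d_\theta}$ and $\mathcal A\subseteq\mathbb R^{d_\alpha}$ are convex and compact, and there are two separate balls of radius $R$ containing $\mathcal A$ and $\Theta$, respectively. $h(\boldsymbol\theta,\boldsymbol\alpha)$ is continuously differentiable in both arguments; $p$ and $q$ are convex and possibly non-differentiable, $p$ is $L_p$-Lipschitz continuous, $q$ is continuous. There are constants $L_{11},L_{22},L_{12}$ such that for all $\boldsymbol\theta,\boldsymbol\theta_1,\boldsymbol\theta_2\in\Theta$ and $\boldsymbol\alpha,\boldsymbol\alpha_1,\boldsymbol\alpha_2\in\mathcal A$: $\|\nabla_{\boldsymbol\theta}h(\boldsymbol\theta_1,\boldsymbol\alpha)-\nabla_{\boldsymbol\theta}h(\boldsymbol\theta_2,\boldsymbol\alpha)\|\le L_{11}\|\boldsymbol\theta_1-\boldsymbol\theta_2\|$, $\|\nabla_{\boldsymbol\alpha}h(\boldsymbol\theta,\boldsymbol\alpha_1)-\nabla_{\boldsymbol\alpha}h(\boldsymbol\theta,\boldsymbol\alpha_2)\|\le L_{22}\|\boldsymbol\alpha_1-\boldsymbol\alpha_2\|$, $\|\nabla_{\boldsymbol\alpha}h(\boldsymbol\theta_1,\boldsymbol\alpha)-\nabla_{\boldsymbol\alpha}h(\boldsymbol\theta_2,\boldsymbol\alpha)\|\le L_{12}\|\boldsymbol\theta_1-\boldsymbol\theta_2\|$, $\|\nabla_{\boldsymbol\theta}h(\boldsymbol\theta,\boldsymbol\alpha_1)-\nabla_{\boldsymbol\theta}h(\boldsymbol\theta,\boldsymbol\alpha_2)\|\le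 L_{12}\|\boldsymbol\alpha_1-\boldsymbol\alpha_2\|$. The $\mathcal O(\cdot)$ constants depend on the problem data but not on $\epsilon$. $\epsilon$-first-order Nash equilibrium: a point $(\bar{\boldsymbol\theta},\bar{\boldsymbol\alpha})$ with $\mathcal X(\bar{\boldsymbol\theta},\bar{\boldsymbol\alpha})\le\epsilon^2$ and $\mathcal Y(\bar{\boldsymbol\theta},\bar{\boldsymbol\alpha})\le\epsilon^2$, where $$\mathcal X(\bar{\boldsymbol\theta},\bar{\boldsymbol\alpha})=-2L_{11}\min_{\boldsymbol\theta\in\Theta}\Big[\langle\nabla_{\boldsymbol\theta}h(\bar{\boldsymbol\theta},\bar{\boldsymbol\alpha}),\boldsymbol\theta-\bar{\boldsymbol\theta}\rangle+q(\boldsymbol\theta)-q(\bar{\boldsymbol\theta})+\tfrac{L_{11}}2\|\boldsymbol\theta-\bar{\boldsymbol\theta}\|^2\Big],$$ $$\mathcal Y(\bar{\boldsymbol\theta},\bar{\boldsymbol\alpha})=2L_{22}\max_{\boldsymbol\alpha\in\mathcal A}\Big[\langle\nabla_{\boldsymbol\alpha}h(\bar{\boldsymbol\theta},\bar{\boldsymbol\alpha}),\boldsymbol\alpha-\bar{\boldsymbol\alpha}\rangle-p(\boldsymbol\alpha)+p(\bar{\boldsymbol\alpha})-\tfrac{L_{22}}2\|\boldsymbol\alpha-\bar{\boldsymbol\alpha}\|^2\Big].$$ The algorithm finds such a point in the sense that $(\boldsymbol\theta_t,\boldsymbol\alpha_{t+1})$ is one for some $t\in\{0,\dots,T-1\}$.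 Multi-step Accelerated Proximal Gradient Descent-Ascent algorithm, with inputs $K,T,N,\eta_1,\eta_2$, $\boldsymbol\alpha_0\in\mathcal A$, $\boldsymbol\theta_0\in\Theta$. Proximal operators with step size $\eta$: $$\rho_{\boldsymbol\alpha}(\tilde{\boldsymbol\theta},\tilde{\boldsymbol\alpha},\eta)=\arg\max_{\boldsymbol\alpha\in\mathcal A}\ \langle\nabla_{\boldsymbol\alpha}h(\tilde{\boldsymbol\theta},\tilde{\boldsymbol\alpha}),\boldsymbol\alpha-\tilde{\boldsymbol\alpha}\rangle-\tfrac1{2\eta}\|\boldsymbol\alpha-\tilde{\boldsymbol\alpha}\|^2-p(\boldsymbol\alpha),$$ $$\rho_{\boldsymbol\theta}(\tilde{\boldsymbol\theta},\tilde{\boldsymbol\alpha},\eta)=\arg\min_{\boldsymbol\theta\in\Theta}\ \langle\nabla_{\boldsymbol\theta}h(\tilde{\boldsymbol\theta},\tilde{\boldsymbol\alpha}),\boldsymbol\theta-\tilde{\boldsymbol\theta}\rangle+\tfrac1{2\eta}\|\boldsymbol\theta-\tilde{\boldsymbol\theta}\|^2+q(\boldsymbol\theta).$$ For $t=0,\dots,T-1$: (i) for $k=0,1,\dots,\lfloor K/N\rfloor$: set $\beta_1=1$, $\mathbf x_0=\boldsymbol\alpha_t$, and $\mathbf y_1=\mathbf x_0$ if $k=0$, while for $k\ge1$ set $\mathbf y_1$ equal to the $\mathbf x_N$ produced in round $k-1$; then for $j=1,\dots,N$ set $\mathbf x_j=\rho_{\boldsymbol\alpha}(\boldsymbol\theta_t,\mathbf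 y_j,\eta_1)$, $\beta_{j+1}=\frac{1+\sqrt{1+4\beta_j^2}}2$, $\mathbf y_{j+1}=\mathbf x_j+\frac{\beta_j-1}{\beta_{j+1}}(\mathbf x_j-\mathbf x_{j-1})$; (ii) set $\boldsymbol\alpha_{t+1}$ equal to the final $\mathbf x_N$; (iii) set $\boldsymbol\theta_{t+1}=\rho_{\boldsymbol\theta}(\boldsymbol\theta_t,\boldsymbol\alpha_{t+1},\eta_2)$.
   Formalization: The gradient of h in α is assumed L22-Lipschitz (and h strongly concave) on {2x−x' : x,x' in A}, not only on A; otherwise the claim fails, since accelerated iterates y_j can leave A. N is rounded up to an integer, and L22>0, L11,L12≥0, L11+L12²/σ>0 are made explicit. *)

(* Defs.v *)
From HB Require Import structures.
From mathcomp Require Import all_boot all_order all_algebra.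
From mathcomp Require Import all_classical all_reals all_analysis.
Set Implicit Arguments.
Unset Strict Implicit.
Unset Printing Implicit Defensive.
Import Order.TTheory GRing.Theory Num.Theory.
Import numFieldNormedType.Exports.
Local Open Scope classical_set_scope.
Local Open Scope ring_scope.

Section Euclidean.
Context {R : realType}.

Definition dotp {d} (u v : 'rV[R]_d) : R := \sum_i u 0 i * v 0 i.

(* The library norm on row vectors is the sup norm; it induces the same topology
   and the same notion of differentiability as the Euclidean norm. *)
Definition enorm {d} (u : 'rV[R]_d) : R := Num.sqrt (dotp u u).

Definition grad {d} (f : 'rV[R]_d -> R) (x : 'rV[R]_d) : 'rV[R]_d :=
  \row_i 'D_(delta_mx 0 i) f x.

Definition lipschitz_enorm {d e} (D : set 'rV[R]_d) (L : R)
    (f : 'rV[R]_d -> 'rV[R]_e) : Prop :=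
  forall x y, D x -> D y -> enorm (f x - f y) <= L * enorm (x - y).

Definition strongly_concave {d} (D : set 'rV[R]_d) (sigma : R)
    (f : 'rV[R]_d -> R) : Prop :=
  forall x y (t : R), D x -> D y -> 0 <= t <= 1 ->
    t * f x + (1 - t) * f y + sigma / 2 * t * (1 - t) * enorm (x - y) ^+ 2
      <= f (t *: x + (1 - t) *: y).

(* [argmin_on x0 D f] is a minimizer of [f] over [D] ([x0] if there is none). *)
Definition argmin_on {d} (x0 : 'rV[R]_d) (D : set 'rV[R]_d)
    (f : 'rV[R]_d -> R) : 'rV[R]_d :=
  xget x0 [set x | D x /\ forall y, D y -> f x <= f y].

Definition argmax_on {d} (x0 : 'rV[R]_d) (D : set 'rV[R]_d)
    (f : 'rV[R]_d -> R) : 'rV[R]_d :=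
  xget x0 [set x | D x /\ forall y, D y -> f y <= f x].

Definition min_on {d} (D : set 'rV[R]_d) (f : 'rV[R]_d -> R) : R :=
  f (argmin_on 0 D f).

Definition max_on {d} (D : set 'rV[R]_d) (f : 'rV[R]_d -> R) : R :=
  f (argmax_on 0 D f).

(* For convex [A] these are exactly the points [x + c *: (x - x')] with
   [x, x'] in [A] and [0 <= c <= 1]. The momentum coefficient
   [(beta_j - 1) / beta_(j+1)] lies in [0, 1), so the extrapolated points [y_j]
   at which the accelerated method evaluates the gradient belong to this set,
   but in general not to [A]. *)
Definition extrapolation {d} (A : set 'rV[R]_d) : set 'rV[R]_d :=
  [set y | exists x x', [/\ A x, A x' & y = 2 *: x - x']].

End Euclidean.

Section Game.
Context {R : realType} {m n : nat}.
Variables (Theta : set 'rV[R]_m) (A : set 'rV[R]_n).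
Variables (h : 'rV[R]_m -> 'rV[R]_n -> R) (p : 'rV[R]_n -> R) (q : 'rV[R]_m -> R).

Definition grad_theta (theta : 'rV[R]_m) (alpha : 'rV[R]_n) : 'rV[R]_m :=
  grad (fun th => h th alpha) theta.

Definition grad_alpha (theta : 'rV[R]_m) (alpha : 'rV[R]_n) : 'rV[R]_n :=
  grad (h theta) alpha.

Definition C1_on (D : set ('rV[R]_m * 'rV[R]_n)) : Prop :=
  [/\ forall z, D z -> differentiable (fun w => h w.1 w.2) z,
      {within D, continuous (fun z => grad_theta z.1 z.2)} &
      {within D, continuous (fun z => grad_alpha z.1 z.2)}].

Record standing_assumptions (rad Lp L11 L22 L12 : R) : Prop := {
  Theta_convex : convex_set Theta;
  Theta_compact : compact Theta;
  A_convex : convex_set A;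
  A_compact : compact A;
  Theta_ball : exists c, forall theta, Theta theta -> enorm (theta - c) <= rad;
  A_ball : exists c, forall alpha, A alpha -> enorm (alpha - c) <= rad;
  h_C1 : C1_on (Theta `*` extrapolation A);
  p_convex : convex_function A p;
  p_lipschitz : forall x y, A x -> A y -> `|p x - p y| <= Lp * enorm (x - y);
  q_convex : convex_function Theta q;
  q_continuous : {within Theta, continuous q};
  grad_theta_lip_theta : forall alpha, A alpha ->
    lipschitz_enorm Theta L11 (grad_theta^~ alpha);
  grad_alpha_lip_alpha : forall theta, Theta theta ->
    lipschitz_enorm A L22 (grad_alpha theta);
  grad_alpha_lip_theta : forall alpha, A alpha ->
    lipschitz_enorm Theta L12 (grad_alpha^~ alpha);
  grad_theta_lip_alpha : forall theta, Theta theta ->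
    lipschitz_enorm A L12 (grad_theta theta)
}.

Definition calX (L11 : R) (tb : 'rV[R]_m) (ab : 'rV[R]_n) : R :=
  - 2 * L11 * min_on Theta (fun theta =>
      dotp (grad_theta tb ab) (theta - tb) + q theta - q tb
      + L11 / 2 * enorm (theta - tb) ^+ 2).

Definition calY (L22 : R) (tb : 'rV[R]_m) (ab : 'rV[R]_n) : R :=
  2 * L22 * max_on A (fun alpha =>
      dotp (grad_alpha tb ab) (alpha - ab) - p alpha + p ab
      - L22 / 2 * enorm (alpha - ab) ^+ 2).

Definition FNE (L11 L22 eps : R) (tb : 'rV[R]_m) (ab : 'rV[R]_n) : Prop :=
  [/\ Theta tb, A ab, calX L11 tb ab <= eps ^+ 2 & calY L22 tb ab <= eps ^+ 2].

Definition prox_alpha (theta' : 'rV[R]_m) (alpha' : 'rV[R]_n) (eta : R)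
    : 'rV[R]_n :=
  argmax_on alpha' A (fun alpha =>
    dotp (grad_alpha theta' alpha') (alpha - alpha')
    - (2 * eta)^-1 * enorm (alpha - alpha') ^+ 2 - p alpha).

Definition prox_theta (theta' : 'rV[R]_m) (alpha' : 'rV[R]_n) (eta : R)
    : 'rV[R]_m :=
  argmin_on theta' Theta (fun theta =>
    dotp (grad_theta theta' alpha') (theta - theta')
    + (2 * eta)^-1 * enorm (theta - theta') ^+ 2 + q theta).

(* Every state of the algorithm carries the number of gradients of [h]
   evaluated so far: one per call to [prox_alpha] or [prox_theta]. *)

(* [x_(j-1)], [y_j], [beta_j] *)
Record apg_state := APGState {
  apg_x : 'rV[R]_n; apg_y : 'rV[R]_n; apg_beta : R; apg_evals : nat }.

Definition apg_step (theta : 'rV[R]_m) (eta1 : R) (s : apg_state) : apg_state :=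
  let x := prox_alpha theta (apg_y s) eta1 in
  let beta := (1 + Num.sqrt (1 + 4 * apg_beta s ^+ 2)) / 2 in
  APGState x (x + ((apg_beta s - 1) / beta) *: (x - apg_x s)) beta
    (apg_evals s).+1.

(* [x_N] and the evaluation count, starting from [x_0], [y_1] and count [c] *)
Definition apg_round (N : nat) (theta : 'rV[R]_m) (eta1 : R)
    (x0 y1 : 'rV[R]_n) (c : nat) : 'rV[R]_n * nat :=
  let s := iter N (apg_step theta eta1) (APGState x0 y1 1 c) in
  (apg_x s, apg_evals s).

(* Every round restarts from [x_0 = alpha_t], while [y_1] is the [x_N] of the
   previous round. *)
Fixpoint apg_rounds (N : nat) (theta : 'rV[R]_m) (eta1 : R)
    (alpha_t : 'rV[R]_n) (c k : nat) : 'rV[R]_n * nat :=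
  if k is k'.+1 then
    let: (y1, c') := apg_rounds N theta eta1 alpha_t c k' in
    apg_round N theta eta1 alpha_t y1 c'
  else apg_round N theta eta1 alpha_t alpha_t c.

Record gda_state := GDAState {
  gda_theta : 'rV[R]_m; gda_alpha : 'rV[R]_n; gda_evals : nat }.

Definition gda_step (K N : nat) (eta1 eta2 : R) (s : gda_state) : gda_state :=
  let: (alpha, c) :=
    apg_rounds N (gda_theta s) eta1 (gda_alpha s) (gda_evals s) (K %/ N)%N in
  GDAState (prox_theta (gda_theta s) alpha eta2) alpha c.+1.

(* the state [(theta_t, alpha_t)] after [t] outer iterations *)
Definition gda_run (K N : nat) (eta1 eta2 : R) (theta0 : 'rV[R]_m)
    (alpha0 : 'rV[R]_n) (t : nat) : gda_state :=
  iter t (gda_step K N eta1 eta2) (GDAState theta0 alpha0 0).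

End Game.

(* [sqrt (8 L22 / sigma) - 1] rounded up to an integer; it exceeds -1 when
   [L22, sigma > 0], so the absolute value only changes the type. *)
Definition inner_steps {R : realType} (L22 sigma : R) : nat :=
  `|Num.ceil (Num.sqrt (8 * L22 / sigma) - 1)|%N.

(* Main.v *)
(** Each restarted round is FISTA with [N + 1 >= sqrt (8 L22 / sigma)], whose rate
    [2 L22 |y_1 - alpha*|^2 / (N + 1)^2], combined with strong concavity, halves
    the gap [max_alpha F(theta_t, alpha) - F(theta_t, alpha)] of the inner
    problem, [F = h - p].  This gap bounds [calY / (2 L22)] directly.  The primal
    function [max_alpha F(theta, alpha) + q(theta)] decreases at each outer step
    by at least [calX / (2 Lg)], [Lg = L11 + L12^2 / sigma], up to an error of the order
    of the square root of the gap; the smoothness of the maximum is replaced by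
    comparing the two maximizers through the strong concavity at one of them.
    Telescoping over [T ~ eps^-2] steps, with the gap of order [eps^4] after
    [k ~ log (1 / eps)] rounds, yields a step with [calX <= eps^2]. *)

Require Import Defs.
From HB Require Import structures.
From mathcomp Require Import all_boot all_order all_algebra.
From mathcomp Require Import all_classical all_reals all_analysis.
From mathcomp Require Import ring lra.
Import Order.TTheory GRing.Theory Num.Theory.
Import numFieldNormedType.Exports.
Set Implicit Arguments.
Unset Strict Implicit.
Unset Printing Implicit Defensive.
Local Open Scope classical_set_scope.
Local Open Scope ring_scope.

(** * Euclidean geometry and convexity *)

Section EuclideanSpace.
Context {R : realType} {d : nat}.
Implicit Types (u v w x y z : 'rV[R]_d) (A : set 'rV[R]_d).

Lemma dotpC u v : dotp u v = dotp v u.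
Proof. by apply: eq_bigr => i _; rewrite mulrC. Qed.

Lemma dotpDl u v w : dotp (u + v) w = dotp u w + dotp v w.
Proof.
by rewrite /dotp -big_split; apply: eq_bigr => i _; rewrite !mxE mulrDl.
Qed.

Lemma dotpNl u v : dotp (- u) v = - dotp u v.
Proof. by rewrite /dotp -sumrN; apply: eq_bigr => i _; rewrite !mxE mulNr. Qed.

Lemma dotpZl a u v : dotp (a *: u) v = a * dotp u v.
Proof. by rewrite /dotp mulr_sumr; apply: eq_bigr => i _; rewrite !mxE mulrA. Qed.

Lemma dotpDr u v w : dotp u (v + w) = dotp u v + dotp u w.
Proof. by rewrite ![dotp u _]dotpC dotpDl. Qed.

Lemma dotpNr u v : dotp u (- v) = - dotp u v.
Proof. by rewrite ![dotp u _]dotpC dotpNl. Qed.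

Lemma dotpZr a u v : dotp u (a *: v) = a * dotp u v.
Proof. by rewrite ![dotp u _]dotpC dotpZl. Qed.

Definition dotpE := (dotpDl, dotpDr, dotpNl, dotpNr, dotpZl, dotpZr).

Lemma dotp_ge0 u : 0 <= dotp u u.
Proof. by apply: sumr_ge0 => i _; rewrite -expr2 sqr_ge0. Qed.

Lemma dotp_eq0 u : dotp u u = 0 -> u = 0.
Proof.
move=> /eqP; rewrite psumr_eq0 => [/allP h|i _]; last by rewrite -expr2 sqr_ge0.
apply/rowP => i; rewrite mxE.
by have := h i (mem_index_enum _); rewrite /= mulf_eq0 orbb => /eqP.
Qed.

Lemma enorm_ge0 u : 0 <= enorm u.
Proof. exact: sqrtr_ge0. Qed.

Lemma sqr_enorm u : enorm u ^+ 2 = dotp u u.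
Proof. by rewrite sqr_sqrtr ?dotp_ge0. Qed.

Lemma enormN u : enorm (- u) = enorm u.
Proof. by rewrite /enorm !dotpE opprK. Qed.

Lemma enormZ a u : enorm (a *: u) = `|a| * enorm u.
Proof.
by rewrite /enorm !dotpE mulrA -expr2 sqrtrM ?sqr_ge0// sqrtr_sqr.
Qed.

Lemma enorm_distC u v : enorm (u - v) = enorm (v - u).
Proof. by rewrite -enormN opprB. Qed.

(** Cauchy-Schwarz: the square of [enorm v *: u - enorm u *: v] is nonnegative, and a factor
    [enorm u * enorm v] cancels after expansion. *)
Lemma dotp_le_enorm u v : dotp u v <= enorm u * enorm v.
Proof.
have [v0|v0] := eqVneq (enorm v) 0.
  have -> : v = 0 by apply: dotp_eq0; rewrite -sqr_enorm v0 expr0n.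
  by rewrite -[X in dotp u X](scale0r 0) dotpZr mul0r mulr_ge0 ?enorm_ge0.
have vp : 0 < enorm v by rewrite lt_def v0 enorm_ge0.
have := dotp_ge0 (enorm v *: u - enorm u *: v).
rewrite !dotpE (dotpC v u) -!sqr_enorm => le0.
have [u0|u0] := eqVneq (enorm u) 0.
  have -> : u = 0 by apply: dotp_eq0; rewrite -sqr_enorm u0 expr0n.
  by rewrite -[X in dotp X v](scale0r 0) dotpZl mul0r mulr_ge0 ?enorm_ge0.
have up : 0 < enorm u by rewrite lt_def u0 enorm_ge0.
have uv : 0 < enorm u * enorm v by rewrite mulr_gt0.
rewrite -subr_ge0 -(pmulr_rge0 _ uv).
move: le0; set a := enorm u; set b := enorm v; set c := dotp u v; nra.
Qed.

Lemma ler_enormD u v : enorm (u + v) <= enorm u + enorm v.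
Proof.
have h : 0 <= enorm u + enorm v by rewrite addr_ge0 ?enorm_ge0.
rewrite -(ler_pXn2r (n := 2)) ?nnegrE ?enorm_ge0//.
rewrite sqr_enorm !dotpE (dotpC v u) sqrrD -!sqr_enorm.
by have := dotp_le_enorm u v; lra.
Qed.

Lemma convex_setP A x y t : convex_set A -> A x -> A y -> 0 <= t <= 1 ->
  A (t *: x + (1 - t) *: y).
Proof.
move=> cA Ax Ay t01; have := cA x y (Itv01 (andP t01).1 (andP t01).2).
by rewrite !inE; apply.
Qed.

Lemma convex_functionP A (f : 'rV[R]_d -> R) x y t :
  convex_function A f -> A x -> A y -> 0 <= t <= 1 ->
  f (t *: x + (1 - t) *: y) <= t * f x + (1 - t) * f y.
Proof.
move=> cf Ax Ay t01; have := cf (Itv01 (andP t01).1 (andP t01).2) x y.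
by rewrite !inE; apply.
Qed.

Lemma sub_extrapolation A : A `<=` extrapolation A.
Proof.
by move=> x Ax; exists x, x; split=> //; rewrite scaler_nat mulr2n addrK.
Qed.

Lemma extrapolation_convex A x y t : convex_set A ->
  extrapolation A x -> extrapolation A y -> 0 <= t <= 1 ->
  extrapolation A (t *: x + (1 - t) *: y).
Proof.
move=> cA [a [b [Aa Ab ->]]] [a' [b' [Aa' Ab' ->]]] t01.
exists (t *: a + (1 - t) *: a'), (t *: b + (1 - t) *: b'); split.
- exact: convex_setP.
- exact: convex_setP.
- by apply/rowP => i; rewrite !mxE; ring.
Qed.

Lemma extrapolationP A x x' c : convex_set A -> A x -> A x' -> 0 <= c <= 1 ->
  extrapolation A (x + c *: (x - x')).
Proof.
move=> cA Ax Ax' c01; exists x, (c *: x' + (1 - c) *: x).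
split=> //; first exact: convex_setP.
by apply/rowP => i; rewrite !mxE; ring.
Qed.

Lemma strongly_concave_sub A B sigma (f : 'rV[R]_d -> R) :
  A `<=` B -> strongly_concave B sigma f -> strongly_concave A sigma f.
Proof. by move=> AB fB x y t /AB Bx /AB By; exact: fB. Qed.

Lemma strongly_concaveB A sigma (f g : 'rV[R]_d -> R) :
  strongly_concave A sigma f -> convex_function A g ->
  strongly_concave A sigma (f \- g).
Proof.
move=> cf cg x y t Ax Ay t01 /=.
by have := cf x y t Ax Ay t01; have := convex_functionP cg Ax Ay t01; lra.
Qed.

(** Divide by [t] and let it tend to 0. This turns inequalities along a segment into first-order
    ones. *)
Lemma le_of_small_slope (a b c : R) :
  (forall t, 0 < t <= 1 -> t * a <= t * b + c * t ^+ 2) -> a <= b.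
Proof.
move=> h; rewrite leNgt; apply/negP => ba.
have cp : 0 <= `|c| by [].
have e0 : 0 < `|c| + (a - b) by lra.
(* With this [t], [|c| * t] is at most [(a - b) / 2], which already contradicts the hypothesis. *)
pose t := (a - b) / (`|c| + (a - b)) / 2.
have t0 : 0 < t by rewrite !divr_gt0 ?subr_gt0.
have t1 : t <= 1.
  rewrite /t ler_pdivrMr// mul1r ler_pdivrMr//; lra.
have := h t; rewrite t0 t1 expr2 => /(_ isT).
have -> : t * b + c * (t * t) = t * (b + c * t) by ring.
rewrite ler_pM2l// leNgt => /negP; apply.
have ct : c * t <= `|c| * t by rewrite ler_pM2r// ler_norm.
suff : `|c| * t < a - b by lra.
have tE : t * (`|c| + (a - b)) = (a - b) / 2.
  by rewrite /t mulrAC divfK// gt_eqF.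
by have := mulr_gt0 t0 (_ : 0 < a - b); rewrite subr_gt0 => /(_ ba); nra.
Qed.

(** Quadratic growth at a maximizer: [x] beats every point of the segment towards [z], and the slope
    at [x] of the strong concavity bound gives the claim. *)
Lemma strongly_concave_max A sigma (f : 'rV[R]_d -> R) x z :
  convex_set A -> strongly_concave A sigma f ->
  A x -> (forall y, A y -> f y <= f x) -> A z ->
  f z + sigma / 2 * enorm (z - x) ^+ 2 <= f x.
Proof.
move=> cA cf Ax mx Az.
apply: (@le_of_small_slope _ _ (sigma / 2 * enorm (z - x) ^+ 2)).
move=> t /andP[t0 t1]; have t01 : 0 <= t <= 1 by rewrite ltW.
have := cf z x t Az Ax t01; have := mx _ (convex_setP cA Az Ax t01).
by lra.
Qed.

(** * Existence of extremizers and continuity *)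

Lemma argmax_onP x0 A (f : 'rV[R]_d -> R) :
  compact A -> {within A, continuous f} -> A !=set0 ->
  A (argmax_on x0 A f) /\ forall y, A y -> f y <= f (argmax_on x0 A f).
Proof.
move=> cA cf A0; have [c cA' mc] := EVT_max_rV A0 cA cf.
apply: (@xgetPex _ x0 [set x | A x /\ forall y, A y -> f y <= f x]).
by exists c; split; [rewrite inE in cA'|move=> y Ay; apply: mc; rewrite inE].
Qed.

Lemma argmin_onP x0 A (f : 'rV[R]_d -> R) :
  compact A -> {within A, continuous f} -> A !=set0 ->
  A (argmin_on x0 A f) /\ forall y, A y -> f (argmin_on x0 A f) <= f y.
Proof.
move=> cA cf A0; have [c cA' mc] := EVT_min_rV A0 cA cf.
apply: (@xgetPex _ x0 [set x | A x /\ forall y, A y -> f x <= f y]).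
by exists c; split; [rewrite inE in cA'|move=> y Ay; apply: mc; rewrite inE].
Qed.

Lemma continuous_dotp (f g : 'rV[R]_d -> 'rV[R]_d) :
  (forall i, continuous (fun x => f x 0 i)) ->
  (forall i, continuous (fun x => g x 0 i)) ->
  continuous (fun x => dotp (f x) (g x)).
Proof.
move=> cf cg; rewrite /dotp.
apply: (@continuous_big _ _ +%R 0 xpredT _ _ _ (fun i x => f x 0 i * g x 0 i)).
  exact: add_continuous.
by move=> i _ x; have := continuousM (cf i x) (cg i x).
Qed.

Lemma continuous_coordB y i : continuous (fun x => (x - y) 0 i).
Proof.
move=> x; have -> : (fun x => (x - y) 0 i) = (fun x => x 0 i) \- cst (y 0 i).
  by apply/funext => z; rewrite /= !mxE.
by apply: continuousB; [exact: coord_continuous|exact: cst_continuous].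
Qed.

Lemma continuous_dotpB g y : continuous (fun x => dotp g (x - y)).
Proof.
apply: (@continuous_dotp (cst g) (fun x => x - y)) => i.
  by move=> x; exact: cst_continuous.
exact: continuous_coordB.
Qed.

Lemma continuous_enorm2 y : continuous (fun x => enorm (x - y) ^+ 2).
Proof.
have -> : (fun x => enorm (x - y) ^+ 2) = (fun x => dotp (x - y) (x - y)).
  by apply/funext => x; rewrite sqr_enorm.
by apply: (@continuous_dotp (fun x => x - y) (fun x => x - y)) => i;
  exact: continuous_coordB.
Qed.

Lemma continuous_enorm y : continuous (fun x => enorm (x - y)).
Proof.
have -> : (fun x => enorm (x - y)) = Num.sqrt \o (fun x => enorm (x - y) ^+ 2).
  by apply/funext => x /=; rewrite sqrtr_sqr ger0_norm ?enorm_ge0.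
move=> x; apply: continuous_comp; first exact: continuous_enorm2.
exact: sqrt_continuous.
Qed.

Lemma within_continuous_sub A (f g : 'rV[R]_d -> R) :
  {within A, continuous f} -> {within A, continuous g} ->
  {within A, continuous (fun x => f x - g x)}.
Proof. exact: within_continuousB. Qed.

Lemma within_continuous_add A (f g : 'rV[R]_d -> R) :
  {within A, continuous f} -> {within A, continuous g} ->
  {within A, continuous (fun x => f x + g x)}.
Proof. exact: within_continuousD. Qed.

Lemma within_continuous_dotpB A g y :
  {within A, continuous (fun x => dotp g (x - y))}.
Proof. exact/continuous_subspaceT/continuous_dotpB. Qed.

Lemma within_continuous_enorm2 A c y :
  {within A, continuous (fun x => c * enorm (x - y) ^+ 2)}.
Proof.
apply: continuous_subspaceT => x.
have c2 := @continuous_enorm2 y x.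
have c1 : {for x, continuous (fun=> c)} by exact: cst_continuous.
exact: (continuousM c1 c2).
Qed.

Lemma lipschitz_continuous A L (f : 'rV[R]_d -> R) :
  (forall x y, A x -> A y -> `|f x - f y| <= L * enorm (x - y)) ->
  {within A, continuous f}.
Proof.
move=> lf; apply/subspace_continuousP => x Ax.
apply/cvgrPdist_le => e e0.
have : (fun y => `|L| * enorm (y - x)) @ nbhs x --> (0 : R).
  rewrite -[X in _ --> X](_ : `|L| * enorm (x - x) = 0).
    by apply: cvgM; [exact: cvg_cst|exact: continuous_enorm].
  by rewrite subrr -(scale0r x) enormZ normr0 mul0r mulr0.
move=> /cvgrPdist_le /(_ e e0) h; rewrite near_withinE.
near=> y => Ay; apply: (le_trans (lf _ _ Ax Ay)).
have : `|0 - `|L| * enorm (y - x)| <= e by near: y.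
rewrite sub0r normrN ger0_norm ?mulr_ge0 ?enorm_ge0// enorm_distC.
by apply: le_trans; rewrite ler_wpM2r ?enorm_ge0 ?ler_norm.
Unshelve. all: by end_near.
Qed.

End EuclideanSpace.

(** * Gradients of smooth functions *)

Section Gradient.
Context {R : realType} {d : nat}.
Implicit Types (v x y : 'rV[R]_d) (D : set 'rV[R]_d) (f : 'rV[R]_d -> R).

(** [grad] collects coordinate derivatives only; differentiability lets them represent the
    differential, by expanding [v] in the basis. *)
Lemma diff_grad f x v : differentiable f x -> 'd f x v = dotp (grad f x) v.
Proof.
move=> df; rewrite {1}(row_sum_delta v) linear_sum /dotp.
by apply: eq_bigr => i _; rewrite linearZ /= mxE deriveE// mulrC.
Qed.

Lemma is_derive_line f y v (t : R) : differentiable f (y + t *: v) ->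
  is_derive t (1 : R) (fun s => f (y + s *: v)) (dotp (grad f (y + t *: v)) v).
Proof.
move=> df; rewrite -diff_grad//.
have dg : is_diff t (fun s : R => y + s *: v) ( *:%R ^~ v).
  have -> : *:%R ^~ v = 0 + *:%R ^~ v :> (R -> 'rV[R]_d) by rewrite add0r.
  exact: is_diffD.
have dfg : is_diff t (f \o (fun s : R => y + s *: v))
    ('d f (y + t *: v) \o ( *:%R ^~ v)).
  by apply: is_diff_comp; exact: differentiableP.
have dd : differentiable (f \o (fun s : R => y + s *: v)) t by exact: ex_diff.
apply: DeriveDef; first exact: diff_derivable.
by rewrite deriveE// diff_val /= scale1r.
Qed.

Lemma is_derive_quadratic (a b t : R) :
  is_derive t (1 : R) (fun s => a * s + b * s ^+ 2) (a + 2 * b * t).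
Proof.
have d1 : is_derive t (1 : R) (a \*: (id : R -> R)) (a *: (1 : R)).
  exact: is_deriveZ.
have d2 : is_derive t (1 : R) (b \*: ((id : R -> R) ^+ 2))
    (b *: ((2 * t) *: (1 : R))).
  exact: is_deriveZ.
have := is_deriveD d1 d2.
have -> : a *: (1 : R) + b *: (2 * t *: (1 : R)) = a + 2 * b * t.
  by rewrite /GRing.scale /=; ring.
by congr is_derive; apply/funext => z; rewrite !fctE.
Qed.

Lemma descent_lemma D L f x y : convex_set D ->
  (forall z, D z -> differentiable f z) -> lipschitz_enorm D L (grad f) ->
  D x -> D y ->
  `|f x - f y - dotp (grad f y) (x - y)| <= L / 2 * enorm (x - y) ^+ 2.
Proof.
move=> cD df Lf Dx Dy; set v := x - y; set c := dotp (grad f y) v.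
set e := enorm v ^+ 2.
have Dt (t : R) : t \in `[0, 1]%R -> D (y + t *: v).
  rewrite in_itv /= => t01; have := convex_setP cD Dx Dy t01.
  by congr D; apply/rowP => i; rewrite !mxE; ring.
have key (s : R) : exists2 t, t \in `[0, 1]%R &
    f x - f y - c - s * e = dotp (grad f (y + t *: v)) v - c - 2 * s * e * t.
  pose F (t : R) := f (y + t *: v) - (c * t + s * e * t ^+ 2).
  pose dF (t : R) := dotp (grad f (y + t *: v)) v - (c + 2 * (s * e) * t).
  have dFP (t : R) : t \in `[0, 1]%R -> is_derive t (1 : R) F (dF t).
    move=> t01; have d1 := is_derive_line (df _ (Dt _ t01)).
    exact: (is_deriveB d1 (is_derive_quadratic c (s * e) t)).
  have dF_oo (t : R) : t \in `]0, 1[%R -> is_derive t (1 : R) F (dF t).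
    by move/subset_itv_oo_cc; exact: dFP.
  have cF : {within `[0, 1], continuous F}.
    by apply: derivable_within_continuous => t t01; case: (dFP _ t01).
  have [t t01] := MVT_segment ler01 dF_oo cF.
  rewrite subr0 mulr1 /F /dF => h; exists t => //.
  have -> : f x = f (y + 1 *: v) by rewrite scale1r /v addrC subrK.
  by move: h; rewrite scale0r addr0; lra.
have bnd (t : R) : t \in `[0, 1]%R ->
    `|dotp (grad f (y + t *: v)) v - c| <= L * e * t.
  move=> t01; have /andP[t0 _] : 0 <= t <= 1 by rewrite in_itv in t01.
  have e1 : enorm (grad f (y + t *: v) - grad f y) <= L * (t * enorm v).
    have := Lf _ _ (Dt _ t01) Dy.
    by rewrite addrAC subrr add0r enormZ ger0_norm.
  have := ler_wpM2r (enorm_ge0 v) e1.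
  have := dotp_le_enorm (grad f (y + t *: v) - grad f y) v.
  have := dotp_le_enorm (grad f (y + t *: v) - grad f y) (- v).
  rewrite enormN dotpNr dotpDl dotpNl -/c ler_norml /e expr2 => h1 h2 h3.
  by apply/andP; split; move: h1 h2 h3; lra.
rewrite ler_norml; apply/andP; split.
- have [t t01 h] := key (- (L / 2)).
  by have := bnd t t01; rewrite ler_norml => /andP[+ _]; move: h; lra.
- have [t t01 h] := key (L / 2).
  by have := bnd t t01; rewrite ler_norml => /andP[_]; move: h; lra.
Qed.

(** Strong concavity bounds [f] from below at [y + t (x - y)], the descent lemma from above. Both
    second-order remainders go into the [t ^+ 2] coefficient [(L + sigma) / 2 * e], which vanishes
    in the limit. *)
Lemma strongly_concave_grad D sigma L f x y : convex_set D ->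
  (forall z, D z -> differentiable f z) -> lipschitz_enorm D L (grad f) ->
  strongly_concave D sigma f -> D x -> D y ->
  f x + sigma / 2 * enorm (x - y) ^+ 2 <= f y + dotp (grad f y) (x - y).
Proof.
move=> cD df Lf sf Dx Dy; set e := enorm (x - y) ^+ 2.
apply: (@le_of_small_slope _ _ _ ((L + sigma) / 2 * e)) => t /andP[t0 t1].
have t01 : 0 <= t <= 1 by rewrite ltW.
have Dt := convex_setP cD Dx Dy t01.
have := sf x y t Dx Dy t01.
have := descent_lemma cD df Lf Dt Dy; rewrite ler_norml => /andP[_].
have -> : t *: x + (1 - t) *: y - y = t *: (x - y).
  by apply/rowP => i; rewrite !mxE; ring.
rewrite enormZ (ger0_norm (ltW t0)) exprMn dotpZr -/e; lra.
Qed.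

End Gradient.

(** * Accelerated proximal gradient for the inner problem *)

(** For a quadratic the strong concavity inequality is an identity, whatever the sign of [c]. *)
Lemma strongly_concave_quadratic (R : realType) d (D : set 'rV[R]_d) g y c :
  strongly_concave D (2 * c) (fun x => dotp g (x - y) - c * enorm (x - y) ^+ 2).
Proof.
move=> x z t _ _ _.
have -> : t *: x + (1 - t) *: z - y = t *: (x - y) + (1 - t) *: (z - y).
  by apply/rowP => i; rewrite !mxE; ring.
have -> : x - z = (x - y) - (z - y) by rewrite opprB addrA subrK.
move: (x - y) (z - y) => u w; rewrite !sqr_enorm !dotpE (dotpC w u).
by rewrite le_eqVlt; apply/orP; left; apply/eqP; field.
Qed.

Section InnerLoop.
Context {R : realType} {m n : nat}.
Variables (A : set 'rV[R]_n) (h : 'rV[R]_m -> 'rV[R]_n -> R).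
Variables (p : 'rV[R]_n -> R) (theta : 'rV[R]_m) (L sigma : R).
Hypothesis A_convex : convex_set A.
Hypothesis A_compact : compact A.
Hypothesis p_convex : convex_function A p.
Hypothesis p_continuous : {within A, continuous p}.
Hypothesis h_diff : forall a, extrapolation A a -> differentiable (h theta) a.
Hypothesis h_lip : lipschitz_enorm (extrapolation A) L (grad_alpha h theta).
Hypothesis h_sc : strongly_concave (extrapolation A) sigma (h theta).
Hypothesis L_gt0 : 0 < L.
Hypothesis sigma_gt0 : 0 < sigma.

Local Notation F := (h theta \- p).
Local Notation prox y := (prox_alpha A h p theta y (1 / L)).
Local Notation step := (apg_step A h p theta (1 / L)).

Lemma objective_strongly_concave : strongly_concave A sigma F.
Proof.
apply: strongly_concaveB => //.
exact: strongly_concave_sub (@sub_extrapolation _ _ A) h_sc.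
Qed.

Lemma objective_continuous : {within A, continuous F}.
Proof.
apply: (within_continuousB (f := h theta)) => //.
apply: continuous_in_subspaceT => a; rewrite inE => /sub_extrapolation /h_diff.
exact: differentiable_continuous.
Qed.

Lemma extrapolation_convex_set : convex_set (extrapolation A).
Proof.
move=> x y t; rewrite !inE => Ax Ay.
by apply: extrapolation_convex => //; apply/andP.
Qed.

Lemma prox_alphaP y : A !=set0 ->
  let G a := dotp (grad_alpha h theta y) (a - y)
             - (2 * (1 / L))^-1 * enorm (a - y) ^+ 2 - p a in
  A (prox y) /\ forall a, A a -> G a <= G (prox y).
Proof.
move=> A0 G; apply: argmax_onP => //.
apply: within_continuous_sub => //; apply: within_continuous_sub.
  exact: within_continuous_dotpB.
exact: within_continuous_enorm2.
Qed.

(** Three-point inequality. The prox objective [G] is [L]-strongly concave, hence grows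
    quadratically away from [prox y]; [G] is compared with [F] by concavity at [z] and by the
    descent lemma at [prox y], both expanded at [y], which may lie outside [A]. *)
Lemma prox_alpha_ineq y z : extrapolation A y -> A z ->
  F z + L / 2 * enorm (z - prox y) ^+ 2 <=
  F (prox y) + L / 2 * enorm (z - y) ^+ 2.
Proof.
move=> Ay Az; have A0 : A !=set0 by exists z.
pose G a := dotp (grad_alpha h theta y) (a - y)
            - (2 * (1 / L))^-1 * enorm (a - y) ^+ 2 - p a.
have e : (2 * (1 / L))^-1 = L / 2 by rewrite mul1r invfM invrK mulrC.
have Gsc : strongly_concave A L G.
  apply: strongly_concaveB => //.
  have := @strongly_concave_quadratic R n A (grad_alpha h theta y) y (L / 2).
  by rewrite e mulrC divfK// pnatr_eq0.
have [Ap mp] := prox_alphaP y A0.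
have := strongly_concave_max A_convex Gsc Ap mp Az.
rewrite /G e => G_ineq.
have Az' := sub_extrapolation Az; have Ap' := sub_extrapolation Ap.
have := strongly_concave_grad extrapolation_convex_set h_diff h_lip h_sc Az' Ay.
have := descent_lemma extrapolation_convex_set h_diff h_lip Ap' Ay.
rewrite ler_norml => /andP[d1 _] d2.
have s0 : 0 <= sigma / 2 * enorm (z - y) ^+ 2.
  by rewrite mulr_ge0 ?sqr_ge0// divr_ge0// ltW.
by move: G_ineq d1 d2; rewrite /grad_alpha /=; lra.
Qed.

Variable xs : 'rV[R]_n.
Hypothesis A_xs : A xs.
Hypothesis xs_max : forall x, A x -> F x <= F xs.

(* The potential of the accelerated method; since
   [beta_(j+1) * (beta_(j+1) - 1) = beta_j ^ 2] it is meaningful for [j = 0],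
   where it is [L / 2] times the squared distance of [y_1] to the maximizer. *)
Let potential (s : apg_state) : R :=
  apg_beta s * (apg_beta s - 1) * (F xs - F (apg_x s)) +
  L / 2 * enorm (apg_beta s *: apg_y s - (apg_beta s - 1) *: apg_x s - xs) ^+ 2.

(** The new [beta] is the positive root of [b * (b - 1) = beta ^+ 2]; its growth by at least 1/2 per
    step yields the quadratic rate. *)
Lemma apg_step_beta (s : @apg_state R n) : 1 <= apg_beta s ->
  apg_beta (step s) * (apg_beta (step s) - 1) = apg_beta s ^+ 2 /\
  apg_beta s + 2^-1 <= apg_beta (step s).
Proof.
rewrite /=; set t := apg_beta s => t1.
have r0 : 0 <= 1 + 4 * t ^+ 2 by have := sqr_ge0 t; lra.
have := sqr_sqrtr r0; have := sqrtr_ge0 (1 + 4 * t ^+ 2).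
set r := Num.sqrt _ => r_ge0 rE; split; first by move: rE; rewrite !expr2; lra.
suff : 2 * t <= r by lra.
by rewrite -(ler_pXn2r (n := 2)) ?nnegrE ?rE ?exprMn//; lra.
Qed.

(** The prox inequality at a suitable convex combination of [xs] and [x], multiplied by [t ^+ 2], is
    the decrease of the potential. *)
Lemma apg_step_potential (s : @apg_state R n) :
  A (apg_x s) -> extrapolation A (apg_y s) -> 1 <= apg_beta s ->
  [/\ A (apg_x (step s)), extrapolation A (apg_y (step s)) &
      potential (step s) <= potential s].
Proof.
case: s => x y t c /= Ax Ay t1; have A0 : A !=set0 by exists x.
have [b1 b2] := apg_step_beta (s := APGState x y t c) t1.
move: b1 b2; rewrite /potential /=.
set t' := (1 + _) / 2; set x' := prox y => t'E t't.
have Ax' : A x' by exact: (prox_alphaP y A0).1.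
have t'_gt0 : 0 < t' by move: t't t1; lra.
split => //.
  (* The momentum coefficient [(t - 1) / t'] is in [0, 1] because [t'] exceeds [t]. *)
  apply: extrapolationP => //; rewrite divr_ge0 ?subr_ge0 ?(ltW t'_gt0)//=.
  by rewrite ler_pdivrMr// mul1r; move: t't; lra.
have t_gt0 : 0 < t by apply: lt_le_trans t1.
have t_neq0 : t != 0 by rewrite gt_eqF.
(* The weight [t^-1] makes [t *: (z - y)] and [t *: (z - x')] the opposites of the vectors inside
   the old and the new potential. *)
set z := t^-1 *: xs + (1 - t^-1) *: x.
have t01 : 0 <= t^-1 <= 1 by rewrite invr_ge0 ltW//= invf_le1.
have Az : A z by exact: convex_setP.
have Fz : t^-1 * F xs + (1 - t^-1) * F x <= F z.
  apply: le_trans (objective_strongly_concave A_xs Ax t01).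
  have /andP[i0 i1] := t01; have s0 := ltW sigma_gt0.
  by rewrite lerDl mulr_ge0 ?sqr_ge0// !mulr_ge0 ?invr_ge0 ?subr_ge0// ltW.
have P := prox_alpha_ineq Ay Az; rewrite -/x' in P.
have e1 : t' *: (x' + (t - 1) / t' *: (x' - x)) - (t' - 1) *: x' - xs
          = - (t *: (z - x')).
  apply/rowP => i; rewrite !mxE.
  by field; rewrite t_neq0 gt_eqF.
have e2 : t *: y - (t - 1) *: x - xs = - (t *: (z - y)).
  by apply/rowP => i; rewrite !mxE; field.
have FE a : h theta a - p a = F a by [].
rewrite e1 e2 !enormN !enormZ gtr0_norm// !exprMn t'E !FE.
have t2 : 0 <= t ^+ 2 by rewrite sqr_ge0.
have := ler_wpM2l t2 P; have := ler_wpM2l t2 Fz.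
have -> : t ^+ 2 * (t^-1 * F xs + (1 - t^-1) * F x) =
   t * F xs + t * (t - 1) * F x by field.
move: (F z) (F x) (F x') (F xs) => a b b' b''.
move: (enorm (z - x') ^+ 2) (enorm (z - y) ^+ 2) => u w.
lra.
Qed.

(** At [beta = 1] the potential contains neither [x0] nor its gap, so the bound depends on [y1]
    alone and restarting from [x0 = alpha_t] is harmless. After [j] steps the state holds
    [beta_(j+1)]; the product bound fails at [j = 0], where [beta * (beta - 1)] is 0. *)
Lemma apg_iter x0 y1 c j : A x0 -> A y1 ->
  let s := iter j step (APGState x0 y1 1 c) in
  [/\ A (apg_x s), extrapolation A (apg_y s),
      (j%:R + 2) / 2 <= apg_beta s,
      (0 < j)%N ->
        (j%:R + 1) ^+ 2 / 4 <= apg_beta s * (apg_beta s - 1) &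
      potential s <= L / 2 * enorm (y1 - xs) ^+ 2].
Proof.
move=> Ax0 Ay1; elim: j => [|j].
  split=> //=; [exact: sub_extrapolation|by rewrite add0r divff|].
  by rewrite /potential /= subrr scale0r subr0 scale1r mulr0 mul0r add0r.
rewrite iterS; set s := iter j _ _ => -[Ax Ay bs _ ps].
have j0 : 0 <= j%:R :> R by [].
have b1 : 1 <= apg_beta s by move: bs; lra.
have [bE b2] := apg_step_beta b1.
have [? ? p2] := apg_step_potential Ax Ay b1.
split => //.
- by move: b2 bs; rewrite -natr1; lra.
- move=> _; rewrite bE -natr1.
  have -> : (j%:R + 1 + 1) ^+ 2 / 4 = ((j%:R + 2) / 2) ^+ 2 :> R by field.
  by rewrite ler_pXn2r ?nnegrE//; move: bs; lra.
- exact: le_trans ps.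
Qed.

Lemma apg_round_rate N x0 y1 c : A x0 -> A y1 -> (0 < N)%N ->
  let x := (apg_round A h p N theta (1 / L) x0 y1 c).1 in
  (N%:R + 1) ^+ 2 * (F xs - F x) <= 2 * L * enorm (y1 - xs) ^+ 2.
Proof.
move=> Ax0 Ay1 N0; have [Ax _ _ /(_ N0) bN pN] := apg_iter c N Ax0 Ay1.
rewrite /apg_round /=; move: Ax bN pN; set s := iter N _ _ => Ax bN.
rewrite /potential.
have : 0 <= L / 2 *
   enorm (apg_beta s *: apg_y s - (apg_beta s - 1) *: apg_x s - xs) ^+ 2.
  by rewrite mulr_ge0 ?sqr_ge0// divr_ge0// ltW.
have gap : 0 <= F xs - F (apg_x s) by rewrite subr_ge0; exact: xs_max.
have := ler_wpM2r gap bN.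
move: (F xs - F (apg_x s)) => g.
by lra.
Qed.

(** Strong concavity and smoothness together give [(sigma - L) * enorm (a - b) ^+ 2 <= 0]. This
    settles the regime [L < sigma], in which [inner_steps] may be 0. *)
Lemma objective_domain_subsingleton a b : L < sigma -> A a -> A b -> a = b.
Proof.
move=> Ls /sub_extrapolation Aa /sub_extrapolation Ab.
have := strongly_concave_grad extrapolation_convex_set h_diff h_lip h_sc Aa Ab.
have := descent_lemma extrapolation_convex_set h_diff h_lip Aa Ab.
rewrite ler_norml => /andP[h1 _] h2; apply/eqP; rewrite -subr_eq0; apply/eqP.
apply: dotp_eq0; apply/eqP; rewrite eq_le dotp_ge0 andbT -sqr_enorm.
have sL : 0 < sigma - L by rewrite subr_gt0.
by rewrite -(pmulr_rle0 _ sL); move: h1 h2; lra.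
Qed.

Local Notation N := (inner_steps L sigma).

(** Here [8 * L / sigma] is at least 8, so its root exceeds 1, the ceiling is positive and the
    absolute value in [inner_steps] is inert. *)
Lemma inner_steps_ge : sigma <= L ->
  (0 < N)%N /\ 8 * L / sigma <= (N%:R + 1) ^+ 2.
Proof.
move=> sL; set k := 8 * L / sigma.
have k8 : 8 <= k by rewrite /k ler_pdivlMr//; lra.
have k0 : 0 <= k by lra.
have r1 : 1 < Num.sqrt k.
  by rewrite -(ltr_pXn2r (n := 2)) ?nnegrE ?sqrtr_ge0// sqr_sqrtr// expr1n; lra.
have c0 : 0 < Num.ceil (Num.sqrt k - 1).
  by rewrite ceil_gt_int subr_gt0.
have NE : N%:R = (Num.ceil (Num.sqrt k - 1))%:~R :> R.
  by rewrite /inner_steps -/k natr_absz gtr0_norm.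
split; first by rewrite /inner_steps absz_gt0 gt_eqF.
rewrite -(sqr_sqrtr k0) ler_pXn2r ?nnegrE ?sqrtr_ge0//.
  by rewrite NE; have := ceil_ge (Num.sqrt k - 1); lra.
Qed.

(** The choice of [N] turns the rate into [4 * g <= sigma * e], with [g] the new gap and [e] the
    squared distance from [y1] to [xs]; quadratic growth bounds [sigma * e] by twice the old gap. *)
Lemma apg_round_gap x0 y1 c : A x0 -> A y1 ->
  let x := (apg_round A h p N theta (1 / L) x0 y1 c).1 in
  A x /\ 2 * (F xs - F x) <= F xs - F y1.
Proof.
move=> Ax0 Ay1 x; have Ax : A x by have [] := apg_iter c N Ax0 Ay1.
split=> //.
have [sL|Ls] := leP sigma L; last first.
  by rewrite (objective_domain_subsingleton Ls Ax A_xs)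
     (objective_domain_subsingleton Ls Ay1 A_xs) !subrr mulr0.
have [N0 Nge] := inner_steps_ge sL.
have : (N%:R + 1) ^+ 2 * (F xs - F x) <= 2 * L * enorm (y1 - xs) ^+ 2.
  exact: apg_round_rate.
have gap : 0 <= F xs - F x by rewrite subr_ge0; exact: xs_max.
have := ler_wpM2r gap Nge.
have := strongly_concave_max A_convex objective_strongly_concave A_xs xs_max Ay1.
move: gap; move: (F xs - F x) (enorm _ ^+ 2) => g e g0.
set f := F xs; set f1 := F y1 => h1 h2 h3.
have h4 : 8 * L / sigma * g <= 2 * L * e by exact: le_trans h3.
have : 8 * L * g <= 2 * L * e * sigma.
  by rewrite -ler_pdivrMr// [8 * L * g / sigma]mulrAC.
have -> : 2 * L * e * sigma = 2 * L * (e * sigma) by ring.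
have -> : 8 * L * g = 2 * L * (4 * g) by ring.
rewrite ler_pM2l ?mulr_gt0// => ge; move: f f1 h1 => f f1 h1; clear h2 h3 h4.
lra.
Qed.

(** Rounds are numbered from 0, so index [k] stands for [k + 1] halvings, each round starting its
    [y1] at the preceding output. *)
Lemma apg_rounds_gap a c k : A a ->
  let x := (apg_rounds A h p N theta (1 / L) a c k).1 in
  A x /\ 2 ^+ k.+1 * (F xs - F x) <= F xs - F a.
Proof.
move=> Aa; elim: k => [|k] /=; first by rewrite expr1; exact: apg_round_gap.
case: apg_rounds => y c' /= [Ay gy].
have [Ax gx] := apg_round_gap c' Aa Ay; split=> //.
apply: le_trans gy; rewrite exprSr -mulrA ler_pM2l ?exprn_gt0//.
Qed.

End InnerLoop.

(** * Number of gradient evaluations *)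

Section EvaluationCount.
Context {R : realType} {m n : nat}.
Variables (A : set 'rV[R]_n) (h : 'rV[R]_m -> 'rV[R]_n -> R).
Variables (p : 'rV[R]_n -> R).

Lemma apg_roundsS theta (N : nat) eta a c k :
  let r := apg_rounds A h p N theta eta a c k in
  apg_rounds A h p N theta eta a c k.+1 = apg_round A h p N theta eta a r.1 r.2.
Proof. by rewrite /=; case: (apg_rounds A h p N theta eta a c k). Qed.

Lemma apg_rounds_evals theta (N : nat) eta a c k :
  (apg_rounds A h p N theta eta a c k).2 = (c + k.+1 * N)%N.
Proof.
have roundE x0 y1 c' : (apg_round A h p N theta eta x0 y1 c').2 = (c' + N)%N.
  by rewrite /apg_round /=; elim: N => [|j]; rewrite ?addn0// iterS addnS => <-.
elim: k => [|k IH].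
  by rewrite -[LHS]/(apg_round _ _ _ _ _ _ _ _ _).2 roundE mul1n.
by rewrite apg_roundsS roundE IH -addnA -mulSnr.
Qed.

(** Rounds 0 to [K %/ N] cost [N] gradients each, and the step in [theta] one more. *)
Lemma gda_run_evals (Theta : set 'rV[R]_m) q K N eta1 eta2 theta0 alpha0 t :
  gda_evals (gda_run Theta A h p q K N eta1 eta2 theta0 alpha0 t) =
  (t * ((K %/ N).+1 * N).+1)%N.
Proof.
elim: t => [//|t]; rewrite /gda_run iterS; set s := iter t _ _ => st.
rewrite /gda_step; have := apg_rounds_evals (gda_theta s) N eta1 (gda_alpha s)
  (gda_evals s) (K %/ N).
by case: apg_rounds => a c /= ->; rewrite st [RHS]mulSnr addnS.
Qed.

End EvaluationCount.

(** * Descent of the primal function *)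

Lemma compact_bounded_fun (R : realType) (T : topologicalType) (D : set T)
    (f : T -> R) : compact D -> {within D, continuous f} ->
  exists2 M, 0 <= M & forall x, D x -> `|f x| <= M.
Proof.
move=> cD cf; have [[x0 Dx0]|D0] := pselect (D !=set0); last first.
  by exists 0 => // x Dx; case: D0; exists x.
have D0 : D !=set0 by exists x0.
have [a _ maxa] := compact_EVT_max D0 cD cf.
have [b _ minb] := compact_EVT_min D0 cD cf.
exists (`|f a| + `|f b|); first by rewrite addr_ge0.
move=> x /mem_set Dx; rewrite ler_norml; apply/andP; split.
  have := minb x Dx; have := ler_norm (- f b); rewrite normrN.
  by have := normr_ge0 (f a); lra.
by have := maxa x Dx; have := ler_norm (f a); have := normr_ge0 (f b); lra.
Qed.

Section OuterLoop.
Context {R : realType} {m n : nat}.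
Variables (Theta : set 'rV[R]_m) (A : set 'rV[R]_n).
Variables (h : 'rV[R]_m -> 'rV[R]_n -> R) (p : 'rV[R]_n -> R) (q : 'rV[R]_m -> R).
Variables (rad Lp L11 L22 L12 sigma : R).
Hypothesis H : standing_assumptions Theta A h p q rad Lp L11 L22 L12.
Hypothesis L11_ge0 : 0 <= L11.
Hypothesis L22_gt0 : 0 < L22.
Hypothesis L12_ge0 : 0 <= L12.
Hypothesis sigma_gt0 : 0 < sigma.
Hypothesis Lg_gt0 : 0 < L11 + L12 ^+ 2 / sigma.
Hypothesis h_sc : forall theta, Theta theta ->
  strongly_concave (extrapolation A) sigma (h theta).
Hypothesis h_lip : forall theta, Theta theta ->
  lipschitz_enorm (extrapolation A) L22 (grad_alpha h theta).
Hypothesis A_neq0 : A !=set0.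

Local Notation F theta := (h theta \- p).
Local Notation Lg := (L11 + L12 ^+ 2 / sigma).
Local Notation best theta := (argmax_on 0 A (F theta)).
Local Notation primal theta := (F theta (best theta) + q theta).
Local Notation gap theta a := (F theta (best theta) - F theta a).

Lemma h_diff_alpha theta a : Theta theta -> extrapolation A a ->
  differentiable (h theta) a.
Proof.
move=> Tt Aa; have [dh _ _] := h_C1 H.
have : differentiable ((fun w => h w.1 w.2) \o (fun a => (theta, a))) a.
  apply: differentiable_comp; last exact: dh.
  by apply: differentiable_pair => //; exact: differentiable_cst.
by [].
Qed.

Lemma h_diff_theta theta a : Theta theta -> A a ->
  differentiable (h^~ a) theta.
Proof.
move=> Tt /sub_extrapolation Aa; have [dh _ _] := h_C1 H.
have : differentiable ((fun w => h w.1 w.2) \o (fun t => (t, a))) theta.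
  apply: differentiable_comp; last exact: dh.
  by apply: differentiable_pair => //; exact: differentiable_cst.
by [].
Qed.

Lemma p_within_continuous : {within A, continuous p}.
Proof. exact: lipschitz_continuous (p_lipschitz H). Qed.

Lemma h_bounded :
  exists2 M, 0 <= M & forall theta a, Theta theta -> A a -> `|h theta a| <= M.
Proof.
have [dh _ _] := h_C1 H.
have cTA : compact (Theta `*` A)
  by exact: compact_setX (Theta_compact H) (A_compact H).
have [|M M0 hM] := compact_bounded_fun (f := fun w => h w.1 w.2) cTA.
  apply: continuous_in_subspaceT => z; rewrite inE => -[Tz Az].
  apply: differentiable_continuous; apply: dh; split=> //.
  exact: sub_extrapolation.
by exists M => // theta a Tt Aa; exact: (hM (theta, a)).
Qed.

Lemma bestP theta : Theta theta ->
  A (best theta) /\ forall a, A a -> F theta a <= F theta (best theta).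
Proof.
move=> Tt; apply: argmax_onP => //; first exact: A_compact H.
apply: (objective_continuous p_within_continuous) => a.
exact: h_diff_alpha.
Qed.

Lemma gap_ge theta a : Theta theta -> A a ->
  sigma / 2 * enorm (a - best theta) ^+ 2 <= gap theta a.
Proof.
move=> Tt Aa; have [Ab mb] := bestP Tt.
have sF := objective_strongly_concave (p_convex H) (h_sc Tt).
by have := strongly_concave_max (A_convex H) sF Ab mb Aa; lra.
Qed.

Lemma gap_ge0 theta a : Theta theta -> A a -> 0 <= gap theta a.
Proof. by move=> Tt Aa; rewrite subr_ge0; exact: (bestP Tt).2. Qed.

(** By the descent lemma with the same constant [L22], the bracket in [calY] at any [x] of [A] is at
    most [F theta x - F theta a]. *)
Lemma calY_le_gap theta a : Theta theta -> A a ->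
  calY A h p L22 theta a <= 2 * L22 * gap theta a.
Proof.
move=> Tt Aa; rewrite /calY ler_pM2l ?mulr_gt0// /max_on.
set G := fun x => _.
have [Ax _] : A (argmax_on 0 A G) /\ forall y, A y -> G y <= G (argmax_on 0 A G).
  apply: argmax_onP => //; first exact: A_compact H.
  apply: within_continuous_sub; last exact: within_continuous_enorm2.
  apply: within_continuous_add; last first.
    by apply: continuous_subspaceT => x; exact: cst_continuous.
  apply: within_continuous_sub; first exact: within_continuous_dotpB.
  exact: p_within_continuous.
move: (argmax_on _ _ _) Ax => x Ax; rewrite /G.
have eA := @extrapolation_convex_set _ _ _ (A_convex H).
have := descent_lemma eA (fun z => h_diff_alpha Tt) (h_lip Tt)
  (sub_extrapolation Ax) (sub_extrapolation Aa).
rewrite ler_norml -/(grad_alpha h theta a) => /andP[d _].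
by have := (bestP Tt).2 x Ax; move: d => /=; lra.
Qed.

(** The objective of the proximal step and the bracket of [calX] with modulus [Lg] differ by the
    constant [q theta]. *)
Lemma prox_thetaP theta a : Theta theta ->
  let G x := dotp (grad_theta h theta a) (x - theta) + q x - q theta
             + Lg / 2 * enorm (x - theta) ^+ 2 in
  let theta' := prox_theta Theta h q theta a Lg^-1 in
  Theta theta' /\ forall x, Theta x -> G theta' <= G x.
Proof.
move=> Tt G theta'.
have T0 : Theta !=set0 by exists theta.
have e : (2 * Lg^-1)^-1 = Lg / 2 by rewrite invfM invrK mulrC.
pose P x := dotp (grad_theta h theta a) (x - theta)
  + (2 * Lg^-1)^-1 * enorm (x - theta) ^+ 2 + q x.
have [T' min'] : Theta theta' /\ forall x, Theta x -> P theta' <= P x.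
  apply: argmin_onP => //; first exact: Theta_compact H.
  apply: within_continuous_add; last exact: q_continuous H.
  apply: within_continuous_add; first exact: within_continuous_dotpB.
  exact: within_continuous_enorm2.
split=> // x /min'; rewrite /P e /G; lra.
Qed.

(* [L * min_L] is monotone in the modulus [L]: rescale the displacement of the
   [L11]-minimizer by [L11 / Lg]. *)
Lemma calX_le_prox theta a
    (theta' := prox_theta Theta h q theta a Lg^-1) : Theta theta ->
  calX Theta h q L11 theta a <=
  - 2 * Lg * (dotp (grad_theta h theta a) (theta' - theta) + q theta' - q theta
             + Lg / 2 * enorm (theta' - theta) ^+ 2).
Proof.
move=> Tt; have [_ min'] := prox_thetaP a Tt.
rewrite /calX /min_on; set G := fun x => _.
have T0 : Theta !=set0 by exists theta.
have [Tx _] : Theta (argmin_on 0 Theta G) /\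
    forall y, Theta y -> G (argmin_on 0 Theta G) <= G y.
  apply: argmin_onP => //; first exact: Theta_compact H.
  apply: within_continuous_add; last exact: within_continuous_enorm2.
  apply: within_continuous_sub; last first.
    by apply: continuous_subspaceT => x; exact: cst_continuous.
  apply: within_continuous_add; first exact: within_continuous_dotpB.
  exact: q_continuous H.
move: (argmin_on _ _ _) Tx => x Tx; rewrite /G.
have Ls : 0 <= L12 ^+ 2 / sigma by rewrite divr_ge0 ?sqr_ge0 ?ltW.
set c := L11 / Lg.
have cLg : c * Lg = L11 by rewrite divfK// gt_eqF.
have c01 : 0 <= c <= 1.
  by rewrite divr_ge0 ?(ltW Lg_gt0)//= ler_pdivrMr// mul1r; lra.
have := min' _ (convex_setP (Theta_convex H) Tx Tt c01); rewrite -/theta'.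
have -> : c *: x + (1 - c) *: theta - theta = c *: (x - theta).
  by apply/rowP => i; rewrite !mxE; ring.
have := convex_functionP (q_convex H) Tx Tt c01.
rewrite enormZ exprMn real_normK ?num_real// dotpZr.
move: (q (_ + _)) (dotp _ (theta' - theta)) (enorm (theta' - theta) ^+ 2).
move: (dotp _ (x - theta)) (enorm (x - theta) ^+ 2) (q x) (q theta) (q theta').
move=> u e q1 q0 q' qc u' e' hq hG.
have {hq hG} : u' + q' - q0 + Lg / 2 * e' <=
    c * u + c * (q1 - q0) + Lg / 2 * (c ^+ 2 * e) by move: hq hG; lra.
(* After multiplication by [Lg] the scale enters only as [c * Lg = L11], which reproduces [L11]
   times the bracket of [calX]. *)
move=> /(ler_wpM2l (ltW Lg_gt0)).
have -> : Lg * (c * u + c * (q1 - q0) + Lg / 2 * (c ^+ 2 * e)) =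
   (c * Lg) * (u + q1 - q0 + (c * Lg) / 2 * e) by field; rewrite gt_eqF.
by rewrite cLg; lra.
Qed.

(** Descend in [theta] with the second argument frozen at [best theta']. Replacing its gradient by
    the one at [a] costs [L12] times the distance from [best theta'] to [a], split at
    [best theta]. *)
Lemma best_descent theta theta' a : Theta theta -> Theta theta' -> A a ->
  F theta' (best theta') <=
  F theta (best theta) + dotp (grad_theta h theta a) (theta' - theta)
  + Lg / 2 * enorm (theta' - theta) ^+ 2
  + L12 * enorm (a - best theta) * enorm (theta' - theta).
Proof.
move=> Tt Tt' Aa; have [Ab _] := bestP Tt; have [Ab' _] := bestP Tt'.
have := gap_ge Tt Ab'.
have := descent_lemma (Theta_convex H) (fun z Tz => h_diff_theta Tz Ab')
  (grad_theta_lip_theta H Ab') Tt' Tt.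
rewrite ler_norml -/(grad_theta h theta _) => /andP[_].
have := dotp_le_enorm (grad_theta h theta (best theta') - grad_theta h theta a)
  (theta' - theta).
have := grad_theta_lip_alpha H Tt Ab' Aa.
have : enorm (best theta' - a) <=
    enorm (best theta' - best theta) + enorm (a - best theta).
  rewrite (enorm_distC a); apply: le_trans (ler_enormD _ _).
  by rewrite addrA subrK.
have := enorm_ge0 (theta' - theta).
rewrite dotpDl dotpNl.
move: (enorm (theta' - theta)) (enorm (best theta' - best theta)) => s r.
move: (enorm (best theta' - a)) (enorm (a - best theta)) => r1 r2.
move: (enorm (grad_theta _ _ _ - _)) => g.
move=> s0 h1 h2 h3 h4 h5.
(* The distance [r] between the two maximizers is paid for by the quadratic growth at [best theta];
   the remainder raises [L11] to [Lg]. *)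
have amgm : L12 * r * s <= sigma / 2 * r ^+ 2 + L12 ^+ 2 / sigma / 2 * s ^+ 2.
  rewrite -subr_ge0; have -> : sigma / 2 * r ^+ 2 + L12 ^+ 2 / sigma / 2 * s ^+ 2
    - L12 * r * s = (sigma * r - L12 * s) ^+ 2 / (2 * sigma).
    by field; rewrite gt_eqF.
  by rewrite divr_ge0 ?sqr_ge0// mulr_ge0// ltW.
have h6 := ler_wpM2r s0 (le_trans h2 (ler_wpM2l L12_ge0 h1)).
move: h3 h4 h5 h6 amgm => /=; lra.
Qed.

Local Notation N := (inner_steps L22 sigma).
Local Notation step K := (gda_step Theta A h p q K N (1 / L22) Lg^-1).

Lemma gda_stepP k (s : gda_state) (s' := step (N * k)%N s) :
  Theta (gda_theta s) -> A (gda_alpha s) ->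
  [/\ A (gda_alpha s'),
      2 ^+ k * gap (gda_theta s) (gda_alpha s') <=
        gap (gda_theta s) (gda_alpha s) &
      gda_theta s' =
        prox_theta Theta h q (gda_theta s) (gda_alpha s') Lg^-1].
Proof.
rewrite {}/s' => Tt Aa; have [Ab mb] := bestP Tt.
have dh := fun a => @h_diff_alpha (gda_theta s) a Tt.
have := apg_rounds_gap (A_convex H) (A_compact H) (p_convex H)
  p_within_continuous dh (h_lip Tt) (h_sc Tt) L22_gt0 sigma_gt0 Ab mb
  (gda_evals s) (N * k %/ N) Aa.
rewrite /gda_step; case: apg_rounds => a c [/= Aa' ga']; split=> //.
(* For [N = 0] no inner step is made, but then [L22 < sigma] and [A] has a single point, so all gaps
   vanish. *)
have [N0|N0] := posnP N.
  have Ls : L22 < sigma.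
    by rewrite ltNge; apply/negP => /(inner_steps_ge sigma_gt0)[]; rewrite N0.
  have sub := objective_domain_subsingleton (A_convex H) dh (h_lip Tt)
    (h_sc Tt) Ls.
  by rewrite (sub _ _ Aa' Aa) (sub _ _ Ab Aa) !subrr mulr0.
apply: le_trans ga'; rewrite mulKn//.
rewrite ler_wpM2r ?(gap_ge0 Tt Aa')// ler_eXn2l ?leqnSn//.
by rewrite ltr1n.
Qed.

Lemma gda_run_mem k theta0 alpha0 t : Theta theta0 -> A alpha0 ->
  let s := gda_run Theta A h p q (N * k)%N N (1 / L22) Lg^-1 theta0 alpha0 t in
  Theta (gda_theta s) /\ A (gda_alpha s).
Proof.
move=> Tt Aa; elim: t => [//|t].
rewrite /gda_run iterS; set s := iter t _ _ => -[Ts As].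
have [As' _ ->] := gda_stepP k Ts As; split=> //.
exact: (prox_thetaP _ Ts).1.
Qed.

Lemma Theta_diameter x y : Theta x -> Theta y -> enorm (x - y) <= 2 * `|rad|.
Proof.
have [c hc] := Theta_ball H; move=> /hc hx /hc hy.
have -> : x - y = (x - c) + (c - y) by rewrite addrA subrK.
apply: (le_trans (ler_enormD _ _)); rewrite (enorm_distC c).
by have := ler_norm rad; lra.
Qed.

Lemma objective_bounded : exists2 B, 0 < B & forall theta a,
  Theta theta -> A a -> `|F theta a| <= B.
Proof.
have [M M0 hM] := h_bounded.
have [P P0 hP] := compact_bounded_fun (A_compact H) p_within_continuous.
(* The extra 1 makes the bound positive, so that it can be cancelled later. *)
exists (M + P + 1); first by rewrite ltr_wpDl ?addr_ge0.
move=> theta a Tt Aa; apply: (le_trans (ler_normB _ _)).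
by apply: ler_wpDr => //; apply: lerD; [exact: hM|exact: hP].
Qed.

Lemma gda_finds_FNE : exists C1 C2 : R, [/\ 0 < C1, 0 < C2 &
  forall (eps : R) (T k : nat) theta0 alpha0,
    0 < eps <= 1 -> C1 * eps ^- 2 <= T%:R -> C2 * eps ^- 4 <= 2 ^+ k ->
    Theta theta0 -> A alpha0 ->
    let run := gda_run Theta A h p q (N * k)%N N (1 / L22) Lg^-1 theta0 alpha0 in
    exists2 t, (t < T)%N &
      FNE Theta A h p q L11 L22 eps (gda_theta (run t)) (gda_alpha (run t.+1))].
Proof.
have [B B_gt0 hB] := objective_bounded; have B0 := ltW B_gt0.
have [Q Q0 hQ] := compact_bounded_fun (Theta_compact H) (q_continuous H).
have g0 := Lg_gt0; set D := 2 * `|rad|; have D0 : 0 <= D by rewrite mulr_ge0.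
(* The primal function ranges over an interval of length at most [2 * (B + Q)] and will lose
   [eps ^+ 2 / (4 * Lg)] per step; the added 1 gives the contradiction. *)
set C1 := 4 * Lg * (2 * (B + Q)) + 1.
(* In [C2], the term [4 * L22 * B] serves the bound on [calY], and [E] is what makes the squared
   descent error at most [(eps ^+ 2 / (4 * Lg)) ^+ 2]. *)
set E := 64 * Lg ^+ 2 * L12 ^+ 2 * D ^+ 2 * B / sigma.
set C2 := 4 * L22 * B + E + 1.
have E0 : 0 <= E.
  apply: divr_ge0 (ltW sigma_gt0).
  by do ?[exact: sqr_ge0 | exact: ler0n | apply: mulr_ge0].
have C1_gt0 : 0 < C1.
  have : 0 <= 4 * Lg * (2 * (B + Q)) by rewrite !mulr_ge0 ?(ltW g0)// addr_ge0.
  by rewrite /C1; lra.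
have LB : 0 <= 4 * L22 * B by rewrite !mulr_ge0// ltW.
have C2_gt0 : 0 < C2 by rewrite /C2; lra.
exists C1, C2; split=> // eps T k theta0 alpha0 /andP[e0 e1] hT hk Tt0 Aa0 run.
have mem t : Theta (gda_theta (run t)) /\ A (gda_alpha (run t)).
  exact: gda_run_mem.
(* The gap at the start of an outer step is at most [2 * B] whatever [t] is, so one [k] serves all
   steps. *)
have small t : gap (gda_theta (run t)) (gda_alpha (run t.+1)) * C2 <=
    2 * B * eps ^+ 4.
  have [Tt Aa] := mem t; have [_ gk _] := gda_stepP k Tt Aa.
  have e4 : 0 < eps ^+ 4 by rewrite exprn_gt0.
  have [_ Aa'] := mem t.+1.
  have gB : gap (gda_theta (run t)) (gda_alpha (run t)) <= 2 * B.
    have [Ab _] := bestP Tt.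
    have := hB _ _ Tt Aa; have := hB _ _ Tt Ab; rewrite !ler_norml.
    by move=> /andP[_ h1] /andP[h2 _]; lra.
  have {}gk := le_trans gk gB.
  have := ler_wpM2r (gap_ge0 Tt Aa') hk => h1.
  have {}h1 := le_trans h1 gk.
  by rewrite -ler_pdivrMr// (mulrC _ C2) mulrAC.
have calY_small t : calY A h p L22 (gda_theta (run t)) (gda_alpha (run t.+1))
    <= eps ^+ 2.
  have [Tt _] := mem t; have [_ Aa'] := mem t.+1.
  apply: (le_trans (calY_le_gap Tt Aa')).
  have := small t; have := gap_ge0 Tt Aa'; move: (gap _ _) => g gg0 hg.
  have e24 : eps ^+ 4 <= eps ^+ 2.
    by rewrite (exprD _ 2 2) ger_pMl ?exprn_gt0// exprn_ile1// ltW.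
  rewrite -(ler_pM2r C2_gt0).
  have h1 : 2 * L22 * g * C2 <= 4 * L22 * B * eps ^+ 2.
    have L2 : 0 <= 2 * L22 by rewrite mulr_ge0// ltW.
    have := ler_wpM2l L2 hg; have := ler_wpM2l LB e24; lra.
  apply: (le_trans h1); rewrite mulrC ler_pM2l ?exprn_gt0// /C2; lra.
have err_small t : L12 * enorm (gda_alpha (run t.+1) - best (gda_theta (run t)))
    * enorm (gda_theta (run t.+1) - gda_theta (run t)) <= eps ^+ 2 / (4 * Lg).
  have [Tt _] := mem t; have [Tt' Aa'] := mem t.+1.
  have := Theta_diameter Tt' Tt; rewrite -/D.
  have := gap_ge Tt Aa'; have := small t; have := gap_ge0 Tt Aa'.
  have := enorm_ge0 (gda_alpha (run t.+1) - best (gda_theta (run t))).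
  have := enorm_ge0 (gda_theta (run t.+1) - gda_theta (run t)).
  move: (gap _ _) (enorm (gda_alpha _ - _)) (enorm (gda_theta _ - _)).
  move=> g r s s0 r0 gg0 hg hr hs.
  apply: (@le_trans _ _ (L12 * r * D)); first by rewrite ler_wpM2l ?mulr_ge0.
  have lhs0 : 0 <= L12 * r * D by rewrite !mulr_ge0.
  have rhs0 : 0 <= eps ^+ 2 / (4 * Lg).
    by rewrite divr_ge0 ?sqr_ge0// mulr_ge0// ltW.
  (* Squares are compared because the gap controls [r ^+ 2]; hence the fourth power of [eps]. *)
  rewrite -(ler_pXn2r (n := 2))//.
  set X := L12 ^+ 2 * D ^+ 2; have X0 : 0 <= X by rewrite mulr_ge0 ?sqr_ge0.
  have -> : (L12 * r * D) ^+ 2 = X * r ^+ 2 by rewrite /X; ring.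
  have -> : (eps ^+ 2 / (4 * Lg)) ^+ 2 = eps ^+ 4 / (16 * Lg ^+ 2).
    by rewrite expr_div_n -exprM exprMn; congr (_ / (_ * _)); ring.
  rewrite ler_pdivlMr ?mulr_gt0 ?exprn_gt0//.
  have h1 : B * (64 * Lg ^+ 2 * X * g) <= B * (2 * eps ^+ 4 * sigma).
    have : E * g <= 2 * B * eps ^+ 4.
      apply: le_trans hg; rewrite mulrC ler_wpM2l// /C2; lra.
    have -> : E * g = B * (64 * Lg ^+ 2 * X * g) / sigma.
      by rewrite /E /X; field; rewrite gt_eqF.
    by rewrite ler_pdivrMr//; congr (_ <= _); ring.
  rewrite ler_pM2l// in h1; rewrite -(ler_pM2r sigma_gt0).
  have Y0 : 0 <= 32 * Lg ^+ 2 * X.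
    by do ?[exact: sqr_ge0 | exact: ler0n | apply: mulr_ge0].
  by have := ler_wpM2l Y0 hr; lra.
have descent t : primal (gda_theta (run t.+1)) <=
    primal (gda_theta (run t)) + eps ^+ 2 / (4 * Lg)
    - calX Theta h q L11 (gda_theta (run t)) (gda_alpha (run t.+1)) / (2 * Lg).
  have [Tt Aa] := mem t; have [Tt' Aa'] := mem t.+1.
  have [_ _ thE] := gda_stepP k Tt Aa.
  have := best_descent Tt Tt' Aa'; have := err_small t.
  have := calX_le_prox (gda_alpha (run t.+1)) Tt; rewrite -thE -/(run t.+1).
  move: (calX _ _ _ _ _ _) (enorm (gda_theta _ - _) ^+ 2) => X e.
  move: (dotp _ _) => u hX.
  set V := u + q (gda_theta (run t.+1)) - q (gda_theta (run t)) + Lg / 2 * e.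
  have {}hX : X / (2 * Lg) <= - V.
    rewrite ler_pdivrMr ?mulr_gt0//; apply: (le_trans hX).
    by rewrite -/V le_eqVlt; apply/orP; left; apply/eqP; ring.
  by move: hX; rewrite /V; lra.
apply: contrapT => noFNE.
have calX_big t : (t < T)%N ->
    eps ^+ 2 < calX Theta h q L11 (gda_theta (run t)) (gda_alpha (run t.+1)).
  move=> tT; rewrite ltNge; apply/negP => hX; apply: noFNE; exists t => //.
  by have [Tt _] := mem t; have [_ Aa'] := mem t.+1.
have tele : forall t, (t <= T)%N -> primal (gda_theta (run t)) <=
    primal (gda_theta (run 0)) - t%:R * (eps ^+ 2 / (4 * Lg)).
  elim=> [|t IH] tT; first by rewrite mul0r subr0.
  have := IH (ltnW tT); have := descent t.
  have := calX_big t tT.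
  rewrite -(ltr_pM2r (_ : 0 < (2 * Lg)^-1)) ?invr_gt0 ?mulr_gt0//.
  (* A step with [calX] above [eps ^+ 2] gains twice [eps ^+ 2 / (4 * Lg)]; the error consumes at
     most half of the gain. *)
  have half (G : R) : G != 0 -> eps ^+ 2 / (2 * G) = 2 * (eps ^+ 2 / (4 * G)).
    by move=> G0; field.
  rewrite half ?gt_eqF//.
  by rewrite -natr1; lra.
have := tele T (leqnn T).
have Pbound t : `|primal (gda_theta (run t))| <= B + Q.
  have [Tt _] := mem t; have [Ab _] := bestP Tt.
  apply: (le_trans (ler_normD _ _)).
  by apply: lerD; [exact: hB|exact: hQ].
have := Pbound T; have := Pbound 0%N; rewrite !ler_norml.
move=> /andP[_ P0] /andP[PT _] PT0.
have h1 : T%:R * (eps ^+ 2 / (4 * Lg)) <= 2 * (B + Q) by lra.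
rewrite mulrA ler_pdivrMr ?mulr_gt0// in h1.
rewrite ler_pdivrMr ?exprn_gt0// in hT.
by have := le_trans hT h1; rewrite /C1; lra.
Qed.

End OuterLoop.

(** * Iteration counts *)

Section Asymptotics.
Context {R : realType}.

(** The absolute value covers negative [x], where [truncn] is 0; the logarithm defining the number
    of rounds may be negative. *)
Lemma truncnS_le (x : R) : (Num.truncn x).+1%:R <= `|x| + 1.
Proof.
rewrite -natr1 lerD2r; have [x0|x0] := leP 0 x.
  by rewrite ger0_norm// truncn_le.
suff -> : Num.truncn x = 0%N by [].
by apply/truncn0Pn; rewrite -ltNge; lra.
Qed.

(** An estimate on a fixed interval to the right of 0 suffices; [|c| + 1] is a positive constant
    whatever the sign of [c]. *)
Lemma bigO_right0 (f : R -> nat) (g : R -> R) (c r : R) : 0 < r ->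
  (forall e, 0 < e <= r -> (f e)%:R <= c * g e /\ 0 <= g e) ->
  (fun e => (f e)%:R : R) =O_ (0^'+) g.
Proof.
move=> r0 fg; apply/eqO_exP; exists (`|c| + 1); first by rewrite ltr_wpDl.
have r_near : \forall e \near (0 : R)^'+, e <= r by exact: nbhs_right_ltW.
have pos : \forall e \near (0 : R)^'+, 0 < e by exact: nbhs_right_gt.
near=> e.
have [|fe ge] := fg e; first by apply/andP; split; near: e.
rewrite ger0_norm// (ger0_norm ge); apply: (le_trans fe).
by rewrite ler_wpM2r//; have := ler_norm c; lra.
Unshelve. all: by end_near.
Qed.

(* For [eps > 1] the parameters are those of accuracy [1]. *)
Lemma iteration_counts (C1 C2 : R) (N : nat) : 0 < C1 -> 0 < C2 ->
  exists T k : R -> nat,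
    [/\ (fun e => (T e)%:R : R) =O_ (0^'+) (fun e => e ^- 2),
        (fun e => (N * k e)%:R : R) =O_ (0^'+) (fun e => ln e^-1),
        (fun e => (T e * ((k e).+1 * N).+1)%:R : R)
          =O_ (0^'+) (fun e => e ^- 2 * ln e^-1) &
        forall eps, 0 < eps -> let e := Num.min eps 1 in
          C1 * e ^- 2 <= (T eps)%:R /\ C2 * e ^- 4 <= 2 ^+ k eps].
Proof.
move=> C1_gt0 C2_gt0; pose m e : R := Num.min e 1.
pose T e := (Num.truncn (C1 * m e ^- 2)).+1.
(* A base-2 logarithm, rounded up so that [2 ^+ k e] dominates [C2 * m e ^- 4]. *)
pose k e := (Num.truncn (ln (C2 * m e ^- 4) / ln 2)).+1.
have ln2 : 0 < ln 2 :> R by rewrite ln_gt0// ltr1n.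
(* Below [expR (- 1)] both [e ^- 2] and [ln e^-1] are at least 1 and absorb additive constants. *)
pose r : R := expR (- 1).
have r0 : 0 < r by exact: expR_gt0.
have r1 : r <= 1 by rewrite -expR0 ler_expR; lra.
have mE e : e <= r -> m e = e.
  by move=> er; apply: min_l; exact: le_trans er r1.
have inv_ge1 e : 0 < e <= r -> 1 <= e ^- 2.
  move=> /andP[e0 er]; rewrite invf_ge1 ?exprn_gt0// exprn_ile1 ?(ltW e0)//.
  exact: le_trans er r1.
have ln_ge1 e : 0 < e <= r -> 1 <= ln e^-1.
  move=> /andP[e0 er]; rewrite lnV ?posrE//.
  have : ln e <= ln r by rewrite ler_ln ?posrE.
  by rewrite /r expRK; lra.
have Tle e : 0 < e <= r -> (T e)%:R <= (C1 + 1) * e ^- 2.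
  move=> er; have /andP[e0 er'] := er.
  apply: (le_trans (truncnS_le _)); rewrite mE// ger0_norm; last first.
    by rewrite mulr_ge0 ?invr_ge0 ?exprn_ge0// ltW.
  by rewrite mulrDl; have := inv_ge1 e er; lra.
(* The 4 comes from the exponent of [e ^- 4], and the final 1 from rounding up. *)
pose c := (`|ln C2| + 4) / ln 2 + 1.
have kle e : 0 < e <= r -> (k e)%:R <= c * ln e^-1.
  move=> er; have l1 := ln_ge1 e er; have /andP[e0 er'] := er.
  apply: (le_trans (truncnS_le _)); rewrite mE//.
  rewrite lnM ?posrE ?invr_gt0 ?exprn_gt0// -exprVn lnXn ?invr_gt0//.
  move: l1; set l := ln e^-1 => l1.
  rewrite normrM [`|(ln 2)^-1|]gtr0_norm ?invr_gt0//.
  have -> : c * l = (`|ln C2| + 4) * l / ln 2 + l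
    by rewrite /c; field; rewrite gt_eqF.
  apply: lerD => //; rewrite ler_pM2r ?invr_gt0//.
  apply: (le_trans (ler_normD _ _)); rewrite mulrDl; apply: lerD.
    by rewrite ler_peMr.
  by rewrite ger0_norm ?mulrn_wge0//; lra.
have c0 : 0 <= c.
  by rewrite addr_ge0// divr_ge0 ?addr_ge0// ltW.
have N0 : 0 <= N%:R :> R by [].
exists T, k; split.
- apply: (@bigO_right0 _ _ (C1 + 1) r) => // e er; split; first exact: Tle.
  by have := inv_ge1 e er; lra.
- apply: (@bigO_right0 _ _ (N%:R * c) r) => // e er; split.
    by rewrite natrM -mulrA ler_wpM2l//; exact: kle.
  by have := ln_ge1 e er; lra.
- apply: (@bigO_right0 _ _ ((C1 + 1) * ((c + 1) * N%:R + 1)) r) => // e er.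
  have i1 := inv_ge1 e er; have l1 := ln_ge1 e er; split; last first.
    by rewrite mulr_ge0//; lra.
  rewrite natrM mulrACA; apply: ler_pM => //; first exact: Tle.
  rewrite -natr1 natrM -[(k e).+1%:R]natr1.
  by have := ler_wpM2r N0 (kle e er); have := ler_wpM2r N0 l1; lra.
- move=> eps eps0 e; split; first exact/ltW/truncnS_gt.
  have e0 : 0 < e by rewrite lt_min eps0/= ltr01.
  have x0 : 0 < C2 * e ^- 4 by rewrite mulr_gt0 ?invr_gt0 ?exprn_gt0.
  rewrite -ler_ln ?posrE ?exprn_gt0// lnXn// -[ln 2 *+ _]mulr_natl -ler_pdivrMr//.
  exact/ltW/truncnS_gt.
Qed.

End Asymptotics.

(** * Passage from accuracy [min eps 1] to [eps], and the complexity bound *)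

Lemma FNE_weaken (R : realType) m n (Theta : set 'rV[R]_m) (A : set 'rV[R]_n)
    h p q L11 L22 (e e' : R) theta a : 0 <= e <= e' ->
  FNE Theta A h p q L11 L22 e theta a -> FNE Theta A h p q L11 L22 e' theta a.
Proof.
move=> /andP[e0 ee'] [Tt Aa hX hY].
have e2 : e ^+ 2 <= e' ^+ 2 by rewrite lerXn2r ?nnegrE// (le_trans e0).
by split=> //; [exact: le_trans hX e2|exact: le_trans hY e2].
Qed.

(** Concavity and smoothness in [alpha] are asked on [extrapolation A] because the gradients are
    evaluated at the points [y_j]. [T], [K] and [G] are chosen before the starting point, so the
    bounds are uniform in it. *)
Theorem corollary1 (R : realType) (m n : nat)
  (Theta : set 'rV[R]_m) (A : set 'rV[R]_n)
  (h : 'rV[R]_m -> 'rV[R]_n -> R) (p : 'rV[R]_n -> R) (q : 'rV[R]_m -> R)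
  (rad Lp L11 L22 L12 sigma : R)
  (H : standing_assumptions Theta A h p q rad Lp L11 L22 L12)
  (L11_ge0 : 0 <= L11) (L22_gt0 : 0 < L22) (L12_ge0 : 0 <= L12)
  (sigma_gt0 : 0 < sigma) (Lg_gt0 : 0 < L11 + L12 ^+ 2 / sigma)
  (h_sc : forall theta, Theta theta ->
     strongly_concave (extrapolation A) sigma (h theta))
  (h_lip : forall theta, Theta theta ->
     lipschitz_enorm (extrapolation A) L22 (grad_alpha h theta)) :
  let eta1 := 1 / L22 in
  let eta2 := (L11 + L12 ^+ 2 / sigma)^-1 in
  let N := inner_steps L22 sigma in
  exists T K G : R -> nat,
    [/\ (fun eps : R => (T eps)%:R : R) =O_ (0^'+) (fun eps : R => eps ^- 2),
        (fun eps : R => (K eps)%:R : R) =O_ (0^'+) (fun eps : R => ln eps^-1),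
        (fun eps : R => (G eps)%:R : R)
          =O_ (0^'+) (fun eps : R => eps ^- 2 * ln eps^-1)
      & forall (eps : R) (theta0 : 'rV[R]_m) (alpha0 : 'rV[R]_n),
          0 < eps -> Theta theta0 -> A alpha0 ->
          let run := gda_run Theta A h p q (K eps) N eta1 eta2 theta0 alpha0 in
          (gda_evals (run (T eps)) <= G eps)%N /\
          exists2 t : nat, (t < T eps)%N &
            FNE Theta A h p q L11 L22 eps
              (gda_theta (run t)) (gda_alpha (run t.+1))].
Proof.
move=> eta1 eta2 N.
have [C1 [C2 [C1_gt0 C2_gt0 hC]]] : exists C1 C2 : R, [/\ 0 < C1, 0 < C2 &
    forall (eps : R) (T k : nat) theta0 alpha0,
      0 < eps <= 1 -> C1 * eps ^- 2 <= T%:R -> C2 * eps ^- 4 <= 2 ^+ k ->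
      Theta theta0 -> A alpha0 ->
      let run := gda_run Theta A h p q (N * k) N eta1 eta2 theta0 alpha0 in
      exists2 t, (t < T)%N &
        FNE Theta A h p q L11 L22 eps
          (gda_theta (run t)) (gda_alpha (run t.+1))].
  (* The constants must exist before any [alpha0] is given; for empty [A] the claim about them is
     vacuous. *)
  have [A0|A0] := pselect (A !=set0).
    exact: (gda_finds_FNE H L11_ge0 L22_gt0 L12_ge0 sigma_gt0 Lg_gt0 h_sc
      h_lip A0).
  exists 1, 1; split=> // eps T k theta0 alpha0 _ _ _ _ Aa.
  by case: A0; exists alpha0.
have [T [k [OT OK OG Tk]]] := iteration_counts N C1_gt0 C2_gt0.
exists T, (fun e => (N * k e)%N), (fun e => (T e * ((k e).+1 * N).+1)%N).
split=> // eps theta0 alpha0 eps0 Tt Aa run; split.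
  rewrite gda_run_evals leq_mul2l; apply/orP; right; rewrite ltnS.
  (* For positive [N] the quotient [(N * k) %/ N] is [k]; for [N = 0] both counts of inner steps are
     0. *)
  by have [->|N0] := posnP N; rewrite ?muln0// mulKn.
have [hT hk] := Tk eps eps0.
have e01 : 0 < Num.min eps 1 <= 1 by rewrite lt_min eps0 ltr01 ge_min lexx orbT.
have [t tT Ht] := hC _ _ _ theta0 alpha0 e01 hT hk Tt Aa.
exists t => //; apply: FNE_weaken Ht.
by rewrite ge_min lexx andbT; have /andP[/ltW] := e01.
Qed.
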